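(* Let $L\colon TM\to\mathbb{R}$ be a Lagrangian satisfying conditions (S), (G) and (B), let $p,q\in M$, and let $c\in\mathbb{R}$ be such that $\mathcal{N}_{p,q}$ is $c$-bounded. Then $\mathcal{J}$ is bounded from below on $\mathcal{N}_{p,q}$.
   Context: $M$ is a smooth connected manifold of dimension $m+1$, $m\ge 1$, with a fixed auxiliary complete Riemannian metric $g$ and norm $\|v\|=\sqrt{g(v,v)}$. For a function $L$ on $TM$: $\partial_vL(x,v)[w]:=\frac{d}{ds}L(x,v+sw)|_{s=0}$; in natural coordinates $(x^i,v^i)$ of $TM$, $\partial_xL(x,v)[w]:=\sum_i\frac{\partial L}{\partial x^i}(x,v)w^i$; $\|\partial_vL(x,v)\|$, $\|\partial_xL(x,v)\|$ are the norms of these linear forms with respect to $g_x$. Since $\partial_xL$ depends on coordinates, bounds on $\|\partial_xL\|$ are read in local charts (the locally bounded function $C$ in the bound may depend on the chart). Condition (S): (i) $L\in C^1(TM)$; (ii) there is a $C^1$ vector field $K$ on $M$ such that $L$ is invariant under the local flow $\psi$ of $K$, i.e. $L(\psi(t,x),\partial_x\psi(t,x)[v])=L(x,v)$ whenever defined, and the Noether charge $N(x,v):=\partial_vL(x,v)[K_x]$ has the form $N(x,v)=Q_x(v)+d(x)$ with $Q$ a $C^1$ one-form and $d$ a $C^1$ function on $M$; (iii) $d$ is invariant by the flow of $K$ and $Q_x(K)<0$ for all $x\in M$. Put $L_c(x,v):=L(x,v)-\frac{Q_x(v)^2}{Q_x(K)}$. Condition (G): there are continuous functions $C,\lambda\colon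 M\to(0,+\infty)$ such that, for all $x\in M$ and $v,v_1,v_2\in T_xM$: $L_c(x,v)\le C(x)(\|v\|^2+1)$; $\|\partial_xL_c(x,v)\|\le C(x)(\|v\|^2+1)$; $\|\partial_vL_c(x,v)\|\le C(x)(\|v\|+1)$; $(\partial_vL_c(x,v_2)-\partial_vL_c(x,v_1))[v_2-v_1]\ge\lambda(x)\|v_2-v_1\|^2$. Condition (B): there are constants $c_1,c_2,c_3,k_1,k_2$ such that, for all $x\in M$: $0<c_1\le\lambda(x)$; $L(x,0)\ge c_2$; $\|\partial_vL(x,0)\|\le c_3$; $0<k_1\le -Q_x(K)$; $|d(x)|\le k_2$. Paths: $\Omega^{1,2}_{p,q}$ is the Hilbert manifold of absolutely continuous curves $z\colon[0,1]\to M$ with $\int_0^1 g(\dot z,\dot z)\,ds<+\infty$, $z(0)=p$, $z(1)=q$; $\mathcal{A}(z)=\int_0^1L(z,\dot z)\,ds$ for $z\in\Omega^{1,2}_{p,q}$; $\mathcal{N}_{p,q}:=\{z\in\Omega^{1,2}_{p,q}: N(z,\dot z)\text{ is constant a.e. on }[0,1]\}$; $\mathcal{J}:=\mathcal{A}|_{\mathcal{N}_{p,q}}$; $\mathcal{J}^c:=\{z\in\mathcal{N}_{p,q}:\mathcal{J}(z)\le c\}$. $\mathcal{N}_{p,q}$ is $c$-bounded if $\mathcal{J}^c\ne\emptyset$ and $\sup_{z\in\mathcal{J}^c}|N(z,\dot z)|<+\infty$ ($N(z,\dot z)$ being identified with its a.e. constant value). *)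

(* Defs.v *)
From HB Require Import structures.
From mathcomp Require Import all_boot all_order all_algebra.
From mathcomp Require Import all_classical all_reals all_analysis.

Set Implicit Arguments.
Unset Strict Implicit.
Unset Printing Implicit Defensive.

Import Order.TTheory GRing.Theory Num.Theory.
Import numFieldNormedType.Exports.

Local Open Scope classical_set_scope.
Local Open Scope ring_scope.

(* Only meant for open [U]. On finite-dimensional [V] (the only case used),
   continuity of the differential in operator norm is the same as continuity of
   its value at each fixed vector [w]. *)
Fixpoint Ck_on (R : realType) (V W : normedModType R) (k : nat) (U : set V)
    (f : V -> W) : Prop :=
  match k with
  | 0%N => forall x, U x -> {for x, continuous f}
  | k'.+1 => (forall x, U x -> differentiable f x) /\
             (forall w, Ck_on k' U (fun x => 'd f x w))
  end.

Definition smooth_on (R : realType) (V W : normedModType R) (U : set V)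
    (f : V -> W) : Prop := forall k, Ck_on k U f.

(* [cmap] and [cinv] are total functions, meaningful only on [cdom] and on
   [cmap @` cdom] respectively. *)
Record chart (R : realType) (n : nat) (T : topologicalType) := Chart {
  cdom : set T ;
  cmap :> T -> 'rV[R]_n ;
  cinv : 'rV[R]_n -> T ;
  cdom_open : open cdom ;
  cimg_open : open (cmap @` cdom) ;
  cmapK : forall x, cdom x -> cinv (cmap x) = x ;
  cmap_continuous : forall x, cdom x -> {for x, continuous cmap} ;
  cinv_continuous : forall u, (cmap @` cdom) u -> {for u, continuous cinv}
}.

Definition cimg (R : realType) (n : nat) (T : topologicalType)
  (phi : chart R n T) : set 'rV[R]_n := phi @` cdom phi.

Record manifold (R : realType) (n : nat) := Manifold {
  carrier :> topologicalType ;
  atlas : set (chart R n carrier) ;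
  chart_at : carrier -> chart R n carrier ;
  chart_at_atlas : forall x, atlas (chart_at x) ;
  chart_at_dom : forall x, cdom (chart_at x) x ;
  atlas_compatible : forall phi psi, atlas phi -> atlas psi ->
    smooth_on (phi @` (cdom phi `&` cdom psi)) (psi \o cinv phi) ;
  manifold_hausdorff : hausdorff_space carrier ;
  manifold_second_countable : @second_countable carrier
}.

Section Manifolds.
Context (R : realType) (n : nat) (M : manifold R n).

Local Notation chart := (chart R n M).
Local Notation mu := (@lebesgue_measure R).

(* A tangent vector at [x] is represented by its coordinates in the preferred
   chart [chart_at x]; its coordinates in any other chart around [x] are
   [in_chart phi v], and [from_chart phi x] is the inverse of [in_chart phi]. *)
Definition tangent (x : M) : normedModType R := 'rV[R]_n.

Definition in_chart (phi : chart) (x : M) (v : tangent x) : 'rV[R]_n :=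
  'd (phi \o cinv (chart_at x)) (chart_at x x) v.

Definition from_chart (phi : chart) (x : M) (h : 'rV[R]_n) : tangent x :=
  'd (chart_at x \o cinv phi) (phi x) h.

Definition tangent_map (f : M -> M) (x : M) (v : tangent x) : tangent (f x) :=
  'd (chart_at (f x) \o f \o cinv (chart_at x)) (chart_at x x) v.

Definition has_velocity (z : R -> M) (t : R) (v : tangent (z t)) : Prop :=
  {for t, continuous z} /\ is_derive t (1 : R^o) (chart_at (z t) \o z) v.

Definition velocity (z : R -> M) (t : R) : tangent (z t) :=
  derive1 (chart_at (z t) \o z) t.

Definition vector_field := forall x : M, tangent x.
Definition covector_field := forall x : M, tangent x -> R.
Definition lagrangian := forall x : M, tangent x -> R.

Definition C1_function (f : M -> R) : Prop :=
  forall phi, atlas phi -> Ck_on 1 (cimg phi) (f \o cinv phi : _ -> R^o).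

Definition C1_vector_field (K : vector_field) : Prop :=
  forall phi, atlas phi ->
    Ck_on 1 (cimg phi) (fun u => in_chart phi (K (cinv phi u))).

Definition C1_one_form (Q : covector_field) : Prop :=
  (forall x (a : R) (v w : tangent x), Q x (a *: v + w) = a * Q x v + Q x w) /\
  forall phi, atlas phi -> forall h : 'rV[R]_n,
    Ck_on 1 (cimg phi)
      (fun u => Q (cinv phi u) (from_chart phi (cinv phi u) h) : R^o).

(* Expression of [L] in the natural coordinates (x^i, v^i) of the tangent
   bundle induced by [phi]. *)
Definition lagrangian_in_chart (phi : chart) (L : lagrangian)
    (uw : 'rV[R]_n * 'rV[R]_n) : R^o :=
  L (cinv phi uw.1) (from_chart phi (cinv phi uw.1) uw.2).

Definition C1_lagrangian (L : lagrangian) : Prop :=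
  forall phi, atlas phi ->
    Ck_on 1 [set uw | cimg phi uw.1] (lagrangian_in_chart phi L).

Definition metric_field := forall x : M, tangent x -> tangent x -> R.

Record riemannian (g : metric_field) : Prop := {
  riem_linear : forall x (a : R) (u v w : tangent x),
    g x (a *: u + v) w = a * g x u w + g x v w ;
  riem_sym : forall x (u v : tangent x), g x u v = g x v u ;
  riem_pos : forall x (v : tangent x), v != 0 -> 0 < g x v v ;
  riem_smooth : forall phi, atlas phi -> forall h k : 'rV[R]_n,
    smooth_on (cimg phi)
      (fun u => g (cinv phi u) (from_chart phi (cinv phi u) h)
                               (from_chart phi (cinv phi u) k) : R^o)
}.

Definition riem_norm (g : metric_field) (x : M) (v : tangent x) : R :=
  Num.sqrt (g x v v).

Definition riem_dual_norm (g : metric_field) (x : M) (l : tangent x -> R) : \bar R :=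
  ereal_sup [set `|l w|%:E | w in [set w : tangent x | riem_norm g w <= 1]].

Definition C1_curve (z : R -> M) : Prop :=
  continuous z /\
  forall phi, atlas phi ->
    Ck_on 1 (z @^-1` cdom phi : set R^o) (phi \o z : R^o -> 'rV[R]_n).

Definition length (g : metric_field) (z : R -> M) : \bar R :=
  (\int[mu]_(t in `[0%R, 1%R]) (riem_norm g (velocity z t))%:E)%E.

(* C^1 curves may have vanishing velocity, hence piecewise C^1 curves can be
   reparametrized as C^1 ones and give the same infimum. *)
Definition rdist (g : metric_field) (x y : M) : \bar R :=
  ereal_inf [set length g z | z in
    [set z : R -> M | [/\ C1_curve z, z 0 = x & z 1 = y]]].

Definition complete_metric (g : metric_field) : Prop :=
  forall u : nat -> M,
    (forall e : R, 0 < e -> exists N : nat, forall i j : nat,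
       (N <= i)%N -> (N <= j)%N -> (rdist g (u i) (u j) < e%:E)%E) ->
    exists x : M, forall e : R, 0 < e -> exists N : nat, forall i : nat,
       (N <= i)%N -> (rdist g (u i) x < e%:E)%E.

(* [psi t x] is the maximal local flow of [K], with domain [D]. *)
Record is_flow (K : vector_field) (D : set (R * M)) (psi : R -> M -> M) :
    Prop := {
  flow_open : open D ;
  flow_interval : forall x, is_interval [set t | D (t, x)] ;
  flow_0 : forall x, D (0, x) /\ psi 0 x = x ;
  flow_velocity : forall t x, D (t, x) ->
    has_velocity (z := psi ^~ x) (t := t) (K (psi t x)) ;
  flow_maximal : forall (I : set R) (z : R -> M),
    open I -> is_interval I -> I 0 ->
    (forall t, I t -> has_velocity (z := z) (t := t) (K (z t))) ->
    forall t, I t -> D (t, z 0) /\ psi t (z 0) = z t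
}.

Definition dv (L : lagrangian) (x : M) (v w : tangent x) : R :=
  'D_w (L x : tangent x -> R^o) v.

(* The partial derivatives are taken in the natural coordinates induced by
   [phi]; the argument [w] is transported to coordinates so that the norm of the
   resulting linear form on the tangent space at [x] can be taken. *)
Definition dx (phi : chart) (L : lagrangian) (x : M) (v w : tangent x) : R :=
  'D_((in_chart phi w, 0) : 'rV[R]_n * 'rV[R]_n)
    (lagrangian_in_chart phi L) (phi x, in_chart phi v).

Definition noether (L : lagrangian) (K : vector_field) (x : M) (v : tangent x) :
  R := dv L v (K x).

Definition condition_S (L : lagrangian) (K : vector_field) (Q : covector_field)
    (d : M -> R) : Prop :=
  [/\ C1_lagrangian L,
      C1_vector_field K,
      exists (D : set (R * M)) (psi : R -> M -> M),
        [/\ is_flow K D psi,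
            forall t x (v : tangent x), D (t, x) ->
              L (psi t x) (tangent_map (psi t) v) = L x v
          & forall t x, D (t, x) -> d (psi t x) = d x],
      [/\ C1_one_form Q, C1_function d
        & forall x (v : tangent x), noether L K v = Q x v + d x]
    & forall x, Q x (K x) < 0].

Definition Lc (L : lagrangian) (K : vector_field) (Q : covector_field) :
  lagrangian := fun x v => L x v - Q x v ^+ 2 / Q x (K x).

Definition condition_G (g : metric_field) (L : lagrangian) (K : vector_field)
    (Q : covector_field) (C lam : M -> R) : Prop :=
  [/\ [/\ continuous C, continuous lam, forall x, 0 < C x & forall x, 0 < lam x],
      forall x (v : tangent x), Lc L K Q v <= C x * (riem_norm g v ^+ 2 + 1),
      forall phi, atlas phi -> exists Cphi : M -> R,
        (forall x, cdom phi x -> {for x, continuous Cphi} /\ 0 < Cphi x) /\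
        forall x (v : tangent x), cdom phi x ->
          (riem_dual_norm g (dx phi (Lc L K Q) v)
             <= (Cphi x * (riem_norm g v ^+ 2 + 1))%:E)%E,
      forall x (v : tangent x),
        (riem_dual_norm g (dv (Lc L K Q) v) <= (C x * (riem_norm g v + 1))%:E)%E
    & forall x (v1 v2 : tangent x),
        lam x * riem_norm g (v2 - v1) ^+ 2 <=
        dv (Lc L K Q) v2 (v2 - v1) - dv (Lc L K Q) v1 (v2 - v1)].

Definition condition_B (g : metric_field) (L : lagrangian) (K : vector_field)
    (Q : covector_field) (d lam : M -> R) : Prop :=
  exists c1 c2 c3 k1 k2 : R,
    [/\ 0 < c1, 0 < k1 & forall x : M,
      [/\ c1 <= lam x,
          c2 <= L x 0,
          (riem_dual_norm g (dv L (0%R : tangent x)) <= c3%:E)%E,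
          k1 <= - Q x (K x)
        & `|d x| <= k2]].

Definition abs_continuous (a b : R) (f : R -> 'rV[R]_n) : Prop :=
  forall e : R, 0 < e -> exists2 delta : R, 0 < delta &
    forall (k : nat) (s t : 'I_k -> R),
      (forall i, [/\ a <= s i, s i <= t i & t i <= b]) ->
      (forall i j, i != j -> t i <= s j \/ t j <= s i) ->
      \sum_(i < k) (t i - s i) < delta ->
      \sum_(i < k) `|f (t i) - f (s i)| < e.

(* Paths are functions on the whole line of which only the restriction to
   [0, 1] matters. *)
Definition abs_continuous_path (z : R -> M) : Prop :=
  {within `[0, 1], continuous z} /\
  forall phi, atlas phi -> forall a b : R, 0 <= a -> a <= b -> b <= 1 ->
    (forall t, a <= t <= b -> cdom phi (z t)) -> abs_continuous a b (phi \o z).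

Definition Omega (g : metric_field) (p q : M) : set (R -> M) :=
  [set z | [/\ abs_continuous_path z,
      (\int[mu]_(t in `[0%R, 1%R]) (g (z t) (velocity z t) (velocity z t))%:E
         < +oo)%E,
      z 0 = p & z 1 = q]].

Definition action (L : lagrangian) (z : R -> M) : \bar R :=
  (\int[mu]_(t in `[0%R, 1%R]) (L (z t) (velocity z t))%:E)%E.

Definition has_charge (L : lagrangian) (K : vector_field) (z : R -> M) (k : R) :
  Prop := {ae mu, forall t, 0 <= t <= 1 -> noether L K (velocity z t) = k}.

Definition Npq (g : metric_field) (L : lagrangian) (K : vector_field) (p q : M) :
    set (R -> M) :=
  [set z | Omega g p q z /\ exists k : R, has_charge L K z k].

Definition Jsub (g : metric_field) (L : lagrangian) (K : vector_field) (p q : M)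
    (c : R) : set (R -> M) :=
  [set z | Npq g L K p q z /\ (action L z <= c%:E)%E].

Definition c_bounded (g : metric_field) (L : lagrangian) (K : vector_field)
    (p q : M) (c : R) : Prop :=
  Jsub g L K p q c !=set0 /\
  (ereal_sup [set `|k|%:E | k in [set k : R |
     exists2 z, Jsub g L K p q c z & has_charge L K z k]] < +oo)%E.

End Manifolds.

(* Main.v *)
From HB Require Import structures.
Require Import Defs.
From mathcomp Require Import all_boot all_order all_algebra.
From mathcomp Require Import all_classical all_reals all_analysis.
From mathcomp Require Import measurable_realfun ring lra.

(** Uniform convexity of [Lc], together with [Lc x 0 = L x 0] and the equality of
    the fibre derivatives of [Lc] and [L] at [0], bounds [Lc] from below by the
    parabola [c2 - c3 t + c1 t^2 / 2] in [t = |v|], hence by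
    [c2 - c3^2 / (2 c1)].  Along a curve of charge [k] the remaining term
    [Q(v)^2 / Q(K)] of [L] is [(k - d)^2 / Q(K) >= - (|k| + k2)^2 / k1], so the
    action is bounded below in terms of [|k|].  On the sublevel [J <= c], [|k|] is
    bounded by assumption, and off it [J > c]. *)

Import Order.TTheory GRing.Theory Num.Theory.
Import numFieldNormedType.Exports.
Import HBNNSimple.

Local Open Scope classical_set_scope.
Local Open Scope ring_scope.

(* [f] need not be measurable: the integral of [f^\-] is a supremum over simple
   functions below [f^\-], each of which is a.e. at most [b]. *)
Lemma ge_integral_ae {d} {T : measurableType d} {R : realType}
    (mu : {measure set T -> \bar R}) (D : set T) (f : T -> \bar R) (b : R) :
  measurable D -> 0 <= b -> {ae mu, forall t, D t -> ((- b)%:E <= f t)%E} ->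
  (- (b%:E * mu D) <= \int[mu]_(t in D) f t)%E.
Proof.
move=> mD b0 fb; rewrite integralE.
suff H : (\int[mu]_(t in D) f^\- t <= b%:E * mu D)%E.
  rewrite -[leLHS]add0e; apply: leeD; first exact: integral_ge0.
  by rewrite leeN2.
rewrite ge0_integralE//; apply: ge_ereal_sup => _ [h /= hf <-].
rewrite -integralT_nnsfun -integral_cst//.
rewrite (integral_mkcond D).
apply: ae_ge0_le_integral.
- by [].
- by move=> t _; rewrite lee_fin; exact: fun_ge0.
- by apply/measurable_EFinP; exact: measurable_funP.
- by move=> t _; rewrite patchE; case: ifP => // _; rewrite lee_fin.
- by apply/(measurable_restrictT _ mD); exact: measurable_cst.
have [N [mN N0 sN]] := fb; exists N; split => // t /= nt; apply: sN => /= ft.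
apply: nt => _; apply: (le_trans (hf t)); rewrite !patchE.
case: ifPn => // /set_mem tD.
by rewrite funenegE ge_max lee_fin b0 andbT leeNl; exact: ft.
Qed.

(** The mean value theorem is applied on [0, 1] to [h], whose derivative is nonnegative on ]0, 1[ by
    the monotonicity hypothesis, so [h 0 <= h 1]. *)
Lemma strongly_convex_lower_bound {R : realType} {V : normedModType R} (f : V -> R^o)
    (v : V) (A : R) :
  (forall u, differentiable f u) ->
  (forall s, 0 < s < 1 -> s * A <= 'D_v f (s *: v) - 'D_v f 0) ->
  f 0 + 'D_v f 0 + A / 2 <= f v.
Proof.
move=> df hA.
pose h (s : R) : R := f (s *: v) - s * 'D_v f 0 - s ^+ 2 * (A / 2).
have dh (s : R) : is_derive s (1 : R) h ('D_v f (s *: v) - 'D_v f 0 - s * A).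
  have dfs : is_derive s (1 : R) (fun s => f (s *: v) : R) ('D_v f (s *: v)).
    (* The difference quotient at [s] along the ray is already the one of [f] at [s *: v] in
       direction [v]. *)
    have E : (fun t : R => t^-1 *: (f ((t *: (1 : R) + s) *: v) - f (s *: v))) =
        (fun t : R => t^-1 *: (f (t *: v + s *: v) - f (s *: v))).
      by apply/funext => t; have -> : t *: (1 : R) = t := mulr1 t; rewrite scalerDl.
    apply: DeriveDef; first by rewrite /derivable/= E; exact: diff_derivable.
    by rewrite /derive/= E.
  rewrite /h; apply: is_derive_eq.
  by rewrite /GRing.scale/=; field.
have [|s /andP[s0 s1]] := @MVT R h _ 0 1 ltr01 (fun s _ => dh s).
  apply: continuous_subspaceT => s.
  by apply: differentiable_continuous; apply/derivable1_diffP; case: (dh s).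
rewrite !bnd_simp in s0 s1.
rewrite /h subr0 mulr1 !scale1r !scale0r expr1n expr0n/= => E.
have := hA s; rewrite s0 s1 => /(_ isT); lra.
Qed.

(** The chart composed with its inverse agrees with the identity on the open chart image, hence has
    the same derivative there. *)
Lemma from_chart_chart_at {R : realType} {n : nat} {M : manifold R n} (x : M)
    (h : 'rV[R]_n) : from_chart (chart_at x) x h = h.
Proof.
have ax := chart_at_atlas x; have dx := chart_at_dom x.
set phi := chart_at x in ax dx *.
rewrite /from_chart -/phi -deriveE; last first.
  have [/= + _] := atlas_compatible ax ax 1; apply.
  by exists x => //; split.
rewrite (@near_eq_derive _ _ _ _ id) ?derive_id//.
apply: (@filterS _ _ _ (cimg phi)).
  by move=> _ [y dy <-] /=; rewrite cmapK.
by apply: open_nbhs_nbhs; split; [exact: cimg_open|exists x].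
Qed.

(** In the preferred chart, [L x] is the coordinate expression of [L] restricted to the affine slice
    of vectors over [chart_at x x]. *)
Lemma differentiable_lagrangian {R : realType} {n : nat} {M : manifold R n}
    (L : lagrangian M) (x : M) (v : tangent x) :
  C1_lagrangian L -> differentiable (L x : tangent x -> R^o) v.
Proof.
move=> /(_ _ (chart_at_atlas x)) [/= + _].
move=> /(_ (chart_at x x, v)) dL.
have -> : (L x : tangent x -> R^o) =
    lagrangian_in_chart (chart_at x) L \o (fun w => (chart_at x x, w)).
  apply/funext => w; rewrite /lagrangian_in_chart/=.
  by rewrite (cmapK (chart_at_dom x)) from_chart_chart_at.
apply: differentiable_comp; last first.
  by apply: dL; exists x => //; exact: chart_at_dom.
exact: differentiable_pair.
Qed.

(** By finite dimension, [l] is a finite combination of the coordinate functions. *)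
Lemma differentiable_linear_rV {R : realType} {n : nat} (l : 'rV[R]_n -> R)
    (v : 'rV[R]_n) :
  (forall a u w, l (a *: u + w) = a * l u + l w) ->
  differentiable (l : _ -> R^o) v.
Proof.
move=> lin.
pose l' : {linear 'rV[R]_n -> R^o} :=
  HB.pack (l : _ -> R^o) (@GRing.isLinear.Build _ _ _ _ _ lin).
have -> : (l : _ -> R^o) = \sum_(i < n) (fun u : 'rV[R]_n => u 0 i * l (delta_mx 0 i)).
  apply/funext => u; rewrite fct_sumE /= [in LHS](row_sum_delta u).
  by rewrite -[l _]/(l' _) linear_sum; apply: eq_bigr => i _; rewrite linearZ.
apply: differentiable_sum => i; apply: differentiableM => //.
exact: differentiable_coord.
Qed.

Lemma riem_normZ {R : realType} {n : nat} {M : manifold R n}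
    (g : metric_field M) (x : M) (a : R) (v : tangent x) :
  riemannian g -> riem_norm g (a *: v) = `|a| * riem_norm g v.
Proof.
move=> rg; have lin := riem_linear rg (x := x).
have g0 w : g x 0 w = 0.
  by have := lin 1 0 0 w; rewrite scaler0 addr0; lra.
have gZ b u w : g x (b *: u) w = b * g x u w.
  by have := lin b u 0 w; rewrite addr0 g0 addr0.
rewrite /riem_norm gZ (riem_sym rg) gZ mulrA -expr2.
by rewrite sqrtrM ?sqr_ge0// sqrtr_sqr.
Qed.

Lemma riem_norm_gt0 {R : realType} {n : nat} {M : manifold R n}
    {g : metric_field M} {x : M} {v : tangent x} :
  riemannian g -> v != 0 -> 0 < riem_norm g v.
Proof. by move=> rg v0; rewrite sqrtr_gt0; exact: riem_pos. Qed.

(** The supremum is tested on the unit vector [v / |v|]; homogeneity of [l] gives back [v]. *)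
Lemma riem_dual_norm_le {R : realType} {n : nat} {M : manifold R n}
    (g : metric_field M) (x : M) (l : tangent x -> R) (c : R) (v : tangent x) :
  riemannian g -> (forall a u, l (a *: u) = a * l u) ->
  (riem_dual_norm g l <= c%:E)%E -> `|l v| <= c * riem_norm g v.
Proof.
move=> rg lZ lc.
have [->|v0] := eqVneq v 0.
  by rewrite -(scale0r (0 : tangent x)) riem_normZ// lZ normr0 !mul0r normr0 mulr0.
have nv := riem_norm_gt0 rg v0.
have : (`|l ((riem_norm g v)^-1 *: v)|%:E <= riem_dual_norm g l)%E.
  apply: ereal_sup_ubound; exists ((riem_norm g v)^-1 *: v) => //=.
  by rewrite riem_normZ// gtr0_norm ?invr_gt0// mulVf ?gt_eqF.
move=> /le_trans/(_ lc); rewrite lee_fin lZ normrM gtr0_norm ?invr_gt0//.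
by rewrite ler_pdivrMl// mulrC.
Qed.

Section Lc_bounds.
Context {R : realType} {n : nat} {M : manifold R n}.
Variables (L : lagrangian M) (K : vector_field M) (Q : covector_field M).
Hypothesis C1L : C1_lagrangian L.
Hypothesis linQ : forall x a (v w : tangent x),
  Q x (a *: v + w) = a * Q x v + Q x w.

Lemma covector0 (x : M) : Q x 0 = 0.
Proof. by have := linQ x 1 (0 : tangent x) 0; rewrite scaler0 addr0; lra. Qed.

Lemma differentiable_Lc (x : M) (v : tangent x) :
  differentiable (@Lc _ _ _ L K Q x : tangent x -> R^o) v.
Proof.
apply: differentiableB; first exact: differentiable_lagrangian.
have dQ := @differentiable_linear_rV _ _ (Q x) v (@linQ x).
apply: differentiableM => //.
exact: differentiableM.
Qed.

(** The correction is quadratic in [Q x], which vanishes at 0, so it has no first-order part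
    there. *)
Lemma dv_Lc0 (x : M) (w : tangent x) : dv (Lc L K Q) 0 w = dv L 0 w.
Proof.
rewrite /dv.
have dL : is_derive (0 : tangent x) w (L x : tangent x -> R^o)
      ('D_w (L x : tangent x -> R^o) 0).
  by apply: DeriveDef => //; apply/diff_derivable/differentiable_lagrangian.
have dQ : is_derive (0 : tangent x) w (Q x : tangent x -> R^o)
      ('D_w (Q x : tangent x -> R^o) 0).
  by apply: DeriveDef => //; apply/diff_derivable/differentiable_linear_rV/linQ.
apply: (@derive_val _ _ _ _ _ (fun v => L x v - Q x v ^+ 2 / Q x (K x) : R^o)).
apply: is_derive_eq.
rewrite covector0.
by rewrite /GRing.scale/=; ring.
Qed.

Lemma Lc_lower_bound (g : metric_field M) (x : M) (c1 c2 c3 : R) (v : tangent x) :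
  riemannian g -> 0 < c1 -> c2 <= L x 0 ->
  (riem_dual_norm g (dv L (0%R : tangent x)) <= c3%:E)%E ->
  (forall v1 v2 : tangent x, c1 * riem_norm g (v2 - v1) ^+ 2 <=
    dv (Lc L K Q) v2 (v2 - v1) - dv (Lc L K Q) v1 (v2 - v1)) ->
  c2 - c3 ^+ 2 / (2 * c1) <= Lc L K Q v.
Proof.
move=> rg c1_gt0 hc2 hc3 conv.
have dvZ (u : tangent x) a (w : tangent x) :
    dv (Lc L K Q) u (a *: w) = a * dv (Lc L K Q) u w.
  by rewrite /dv !deriveE ?linearZ//; exact: differentiable_Lc.
have dv0 : `|dv (Lc L K Q) 0 v| <= c3 * riem_norm g v.
  apply: riem_dual_norm_le => //.
  by rewrite (_ : dv (Lc L K Q) _ = dv L (0 : tangent x)) //; apply/funext/dv_Lc0.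
have := @strongly_convex_lower_bound _ _ (@Lc _ _ _ L K Q x : tangent x -> R^o) v
  (c1 * riem_norm g v ^+ 2) (@differentiable_Lc x).
have -> : Lc L K Q (0 : tangent x) = L x 0.
  by rewrite /Lc covector0 expr0n/= mul0r subr0.
set D := 'D_v _ 0 => taylor; apply: (le_trans _ (taylor _)).
  move: dv0; rewrite ler_norml => /andP[+ _].
  rewrite -[dv _ _ _]/D; set t := riem_norm g v => hD.
  (* Completing the square: the parabola has its minimum at [t = c3 / c1]. *)
  have : 0 <= (c1 * t - c3) ^+ 2 / (2 * c1).
    by rewrite divr_ge0 ?sqr_ge0// mulr_ge0// ltW.
  have -> : (c1 * t - c3) ^+ 2 / (2 * c1) =
      c1 * t ^+ 2 / 2 - c3 * t + c3 ^+ 2 / (2 * c1).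
    by field; rewrite gt_eqF.
  lra.
(* Monotonicity between 0 and [s *: v] has a factor [s ^+ 2] on the left and [s] on the right; one
   [s > 0] cancels. *)
move=> s /andP[s0 _].
have := conv 0 (s *: v); rewrite subr0 riem_normZ// !dvZ exprMn real_normK ?num_real//.
by rewrite -mulrBr mulrCA expr2 -mulrA ler_pM2l.
Qed.

Lemma lagrangian_lower_bound (x : M) (v : tangent x) (k1 b r : R) :
  0 < k1 -> k1 <= - Q x (K x) -> `|Q x v| <= b -> r <= Lc L K Q v ->
  r - b ^+ 2 / k1 <= L x v.
Proof.
move=> k1_gt0 hk1 Qb; rewrite /Lc => rL.
suff : - (Q x v ^+ 2 / Q x (K x)) <= b ^+ 2 / k1 by lra.
(* With the sign moved to the denominator, both factors are nonnegative and can be compared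
   separately. *)
rewrite -mulrN -invrN; apply: ler_pM.
- exact: sqr_ge0.
- by rewrite invr_ge0 (le_trans _ hk1)// ltW.
- by rewrite -[leLHS]real_normK ?num_real// lerXn2r// nnegrE (le_trans _ Qb).
- by rewrite lef_pV2// posrE (lt_le_trans k1_gt0).
Qed.

End Lc_bounds.

Theorem proposition5p2 (R : realType) (m : nat) (M : manifold R m.+1)
    (g : metric_field M) (L : lagrangian M) (K : vector_field M)
    (Q : covector_field M) (d C lam : M -> R) (p q : M) (c : R) :
  (1 <= m)%N ->
  connected [set: M] ->
  riemannian g ->
  complete_metric g ->
  condition_S L K Q d ->
  condition_G g L K Q C lam ->
  condition_B g L K Q d lam ->
  c_bounded g L K p q c ->
  exists b : R, forall z : R -> M,
    Npq g L K p q z -> (b%:E <= action L z)%E.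
Proof.
move=> _ _ rg _ [C1L _ _ [[linQ _] _ noetherE] _] [_ _ _ _ conv].
move=> [c1 [c2 [c3 [k1 [k2 [c1_gt0 k1_gt0 hB]]]]]] [_ bounded].
have [B hcharge] : exists B : R, forall z k, Jsub g L K p q c z ->
    has_charge L K z k -> `|k| <= B.
  move: bounded; set S := ereal_sup _ => S_lty.
  have ub z k : Jsub g L K p q c z -> has_charge L K z k -> (`|k|%:E <= S)%E.
    by move=> Jz kz; apply: ereal_sup_ubound; exists k => //; exists z.
  (* [fine] returns a default value at infinities; [S] is above -oo because it dominates the given
     [|k|]. *)
  exists (fine S) => z k Jz kz; have kS := ub _ _ Jz kz.
  rewrite -lee_fin fineK// fin_numElt S_lty andbT.
  exact: lt_le_trans (ltNyr _) kS.
(* A pointwise lower bound of [L] along sublevel curves, where [|Q| <= |k| + |d| <= B + k2]. *)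
pose r := c2 - c3 ^+ 2 / (2 * c1) - (B + k2) ^+ 2 / k1.
(* [c] serves the curves off the sublevel; [r] is weakened to minus its absolute value because
   [ge_integral_ae] takes the opposite of a nonnegative constant. *)
exists (Num.min c (- `|r|)) => z Nz.
have [Jc|/ltW cJ] := leP (action L z) c%:E; last first.
  by apply: le_trans cJ; rewrite lee_fin ge_min lexx.
have [_ [k kz]] := Nz.
have kB := hcharge _ _ (conj Nz Jc) kz.
apply: (@le_trans _ _ (- `|r|)%:E); first by rewrite lee_fin ge_min lexx orbT.
have -> : (- `|r|)%:E = (- (`|r|%:E * lebesgue_measure `[0%R, 1%R]%classic))%E :> \bar R.
  by rewrite lebesgue_measure_itv/= lte_fin ltr01 oppr0 adde0 mule1 EFinN.
apply: ge_integral_ae => //.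
(* The bound holds at each time of [0, 1] where the charge equals [k], so the null set of [kz] also
   works here. *)
have [N [mN N0 sN]] := kz; exists N; split => //.
apply: subset_trans sN => t; apply: contra_not => kt; rewrite /= in_itv/= => t01.
rewrite lee_fin; apply: (@le_trans _ _ r); first by rewrite lerNl -normrN ler_norm.
have [hlam hc2 hc3 hk1 hd] := hB (z t).
apply: (lagrangian_lower_bound L K Q _ _ _ _ _ k1_gt0 hk1).
  have := kt t01; rewrite noetherE => kE; rewrite -kE in kB.
  rewrite -[Q _ _](addrK (d (z t))).
  by apply: (le_trans (ler_normB _ _)); exact: lerD.
apply: (Lc_lower_bound _ _ _ C1L linQ _ _ _ _ _ _ rg c1_gt0 hc2 hc3) => v1 v2.
by apply: le_trans (conv _ _ _); rewrite ler_wpM2r ?sqr_ge0.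
Qed.
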